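(* Let $(E_n)_{n\in\mathbb{Z}}$ be the Perrin sequence extended to all integers: $E_0=3$, $E_1=0$, $E_2=2$ and $E_n=E_{n-2}+E_{n-3}$ for all integers $n$. Then for every integer $n\ge 1$: (a) $\sum_{k=1}^{n}E_{-k}=-2E_{-n-1}-2E_{-n-2}-E_{-n-3}+2.$ (b) $\sum_{k=1}^{n}E_{-2k}=-E_{-2n+1}.$ (c) $\sum_{k=1}^{n}E_{-2k+1}=-E_{-2n}-E_{-2n-1}+2.$ *)

(* Defs.v *)
From mathcomp Require Import all_boot all_order all_algebra.
From mathcomp Require Import zify ring lra.

Set Implicit Arguments.
Unset Strict Implicit.
Unset Printing Implicit Defensive.

Import Order.TTheory GRing.Theory Num.Theory.
Local Open Scope ring_scope.

Definition is_perrin (E : int -> int) : Prop :=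
  [/\ E 0 = 3, E 1 = 0, E 2 = 2 &
      forall n : int, E n = E (n - 2) + E (n - 3)].

(* [is_perrin] determines exactly one sequence: [perrin_exists] and
   [perrin_unique].  For the existence, iterate the recurrence on windows
   (E m, E (m + 1), E (m + 2)), forwards and backwards from m = 0. *)
Definition perrin_up (s : int * int * int) : int * int * int :=
  let: (a, b, c) := s in (b, c, a + b).
Definition perrin_down (s : int * int * int) : int * int * int :=
  let: (a, b, c) := s in (c - a, a, b).

Definition perrin_window (m : int) : int * int * int :=
  match m with
  | Posz k => iter k perrin_up (3, 0, 2)
  | Negz k => iter k.+1 perrin_down (3, 0, 2)
  end.

Lemma perrin_downK : cancel perrin_down perrin_up.
Proof. by move=> [[a b] c] /=; rewrite subrK. Qed.

Lemma perrin_windowS (m : int) : perrin_window (m + 1) = perrin_up (perrin_window m).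
Proof.
case: m => [k | [|k]].
- by rewrite -PoszD addn1.
- by [].
- have -> : Negz k.+1 + 1 = Negz k by lia.
  rewrite [perrin_window (Negz k.+1)]/(perrin_window _) /perrin_window.
  by rewrite [iter k.+2 _ _]iterS perrin_downK.
Qed.

Lemma perrin_exists : exists E : int -> int, is_perrin E.
Proof.
exists (fun m => (perrin_window m).1.1); split => // n.
have E3 : n = n - 3 + 1 + 1 + 1 by lia.
have E2 : n - 2 = n - 3 + 1 by lia.
rewrite E2 [in LHS]E3 !perrin_windowS.
by case: (perrin_window (n - 3)) => [[a b] c] /=; rewrite addrC.
Qed.

Lemma perrin_unique (E F : int -> int) : is_perrin E -> is_perrin F -> E =1 F.
Proof.
move=> [E0 E1 E2 rE] [F0 F1 F2 rF].
have pos (k : nat) : [/\ E k = F k, E (k%:Z + 1) = F (k%:Z + 1) &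
                         E (k%:Z + 2) = F (k%:Z + 2)].
  elim: k => [|k [h0 h1 h2]]; first by rewrite !add0r E0 E1 E2 F0 F1 F2.
  have e1 : k.+1%:Z = k%:Z + 1 by lia.
  have e2 : k.+1%:Z + 1 = k%:Z + 2 by lia.
  have e3 : k.+1%:Z + 2 - 2 = k%:Z + 1 by lia.
  have e4 : k.+1%:Z + 2 - 3 = k%:Z by lia.
  by split; rewrite ?e2 ?e1 // -?e1 rE rF e3 e4 h0 h1.
have neg (k : nat) : [/\ E (- k%:Z) = F (- k%:Z), E (- k%:Z + 1) = F (- k%:Z + 1) &
                         E (- k%:Z + 2) = F (- k%:Z + 2)].
  elim: k => [|k [h0 h1 h2]]; first by rewrite oppr0 !add0r E0 E1 E2 F0 F1 F2.
  have e1 : - k.+1%:Z + 1 = - k%:Z by lia.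
  have e2 : - k.+1%:Z + 2 = - k%:Z + 1 by lia.
  have e3 : - k%:Z + 2 - 2 = - k%:Z by lia.
  have e4 : - k%:Z + 2 - 3 = - k.+1%:Z by lia.
  split; rewrite ?e2 ?e1 //.
  have := rE (- k%:Z + 2); have := rF (- k%:Z + 2).
  by rewrite e3 e4 h2 h0 => -> /addrI.
case=> k; first by case: (pos k).
by rewrite NegzE; case: (neg k.+1).
Qed.

(* Main.v *)
Require Import Defs.
From mathcomp Require Import all_boot all_order all_algebra.
From mathcomp Require Import zify.

Set Implicit Arguments.
Unset Strict Implicit.
Unset Printing Implicit Defensive.

Import Order.TTheory GRing.Theory Num.Theory.
Local Open Scope ring_scope.

(** Each sum telescopes: passing from [n] to [n + 1], the change of the right-hand side equals the
    added term by a single instance of the recurrence. Induction on [n] then leaves only the initial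
    values. *)

(** Index relations are premises, so [lia] can check them whatever the syntactic form of the
    indices. *)
Lemma perrin_rec (E : int -> int) (a b c : int) :
  is_perrin E -> b = a - 2 -> c = a - 3 -> E a = E b + E c.
Proof. by move=> [_ _ _ rE] -> ->. Qed.

Theorem corollary3p11 (E : int -> int) (hE : is_perrin E) (n : nat) (hn : (1 <= n)%N) :
  [/\ \sum_(1 <= k < n.+1) E (- k%:Z)
        = - 2 * E (- n%:Z - 1) - 2 * E (- n%:Z - 2) - E (- n%:Z - 3) + 2,
      \sum_(1 <= k < n.+1) E (- 2 * k%:Z) = - E (- 2 * n%:Z + 1)
    & \sum_(1 <= k < n.+1) E (- 2 * k%:Z + 1)
        = - E (- 2 * n%:Z) - E (- 2 * n%:Z - 1) + 2].
Proof.
have rec a b c := @perrin_rec E a b c hE.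
have [E0 E1 E2 _] := hE.
clear hn; elim: n => [|n [IHa IHb IHc]].
  rewrite !big_geq // !mulr0 !oppr0 !add0r E0 E1.
  (* Empty sums, [n = 0]: running the recurrence backwards gives [E (-1) = -1], [E (-2) = 1],
     [E (-3) = 2]. *)
  have := rec 2 0 (-1); have := rec 1 (-1) (-2); have := rec 0 (-2) (-3).
  by split; lia.
rewrite !(big_nat_recr n.+1) //= IHa IHb IHc.
(* Normalize the indices so that equal values of [E] become identical atoms for [lia]. *)
have -> : - n.+1%:Z = - n%:Z - 1 by lia.
have -> : - n%:Z - 1 - 1 = - n%:Z - 2 by lia.
have -> : - n%:Z - 1 - 2 = - n%:Z - 3 by lia.
have -> : - n%:Z - 1 - 3 = - n%:Z - 4 by lia.
have -> : - 2 * n.+1%:Z = - 2 * n%:Z - 2 by lia.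
have -> : - 2 * n%:Z - 2 + 1 = - 2 * n%:Z - 1 by lia.
have -> : - 2 * n%:Z - 2 - 1 = - 2 * n%:Z - 3 by lia.
(* These three instances settle (a), (b) and (c) respectively. *)
have := rec (- n%:Z - 1) (- n%:Z - 3) (- n%:Z - 4).
have := rec (- 2 * n%:Z + 1) (- 2 * n%:Z - 1) (- 2 * n%:Z - 2).
have := rec (- 2 * n%:Z) (- 2 * n%:Z - 2) (- 2 * n%:Z - 3).
by split; lia.
Qed.
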